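(* For any exact category $\mathbf{E}$ there is a natural isomorphism of abelian groups $$D(\mathbf{E})\;\cong\;K_1^{\mathrm{wcs}}\,\mathbf{E}.$$
   Context: $\mathbf{E}$ is an exact category (in Quillen's sense) with a distinguished zero object $*$, regarded as a Waldhausen category whose cofibrations are the admissible monomorphisms, whose cofiber sequences are the short exact sequences and whose weak equivalences are the isomorphisms. Naturality is with respect to exact functors. $D(\mathbf{E})$ (Nenashev) is the abelian group generated by pairs of short exact sequences on the same objects, $A\xrightarrow{j_i}B\xrightarrow{r_i}C$ ($i=1,2$), denoted $\{j_1,r_1;j_2,r_2\}$, subject to two kinds of relations. First, a generator vanishes if $j_1=j_2$ and $r_1=r_2$. Second, given six pairs of short exact sequences, for $i=1,2$, $\lambda^A: A'\xrightarrow{j^A_i}A\xrightarrow{r^A_i}A''$; $\lambda^B: B'\xrightarrow{j^B_i}B\xrightarrow{r^B_i}B''$; $\lambda^C: C'\xrightarrow{j^C_i}C\xrightarrow{r^C_i}C''$; $\lambda': A'\xrightarrow{j'_i}B'\xrightarrow{r'_i}C'$; $\lambda: A\xrightarrow{j_i}B\xrightarrow{r_i}C$; $\lambda'': A''\xrightarrow{j''_i}B''\xrightarrow{r''_i}C''$, such that for each $i=1,2$ the $3\times3$ diagram with rows $\lambda^A_i,\lambda^B_i,\lambda^C_i$ and columns $\lambda'_i,\lambda_i,\lambda''_i$ commutes (i.e. $j_ij^A_i=j^B_ij'_i$, $j''_ir^A_i=r^B_ij_i$, $r_ij^B_i=j^C_ir'_i$, $r''_ir^B_i=r^C_ir_i$),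 one has $\{\lambda^A\}-\{\lambda^B\}+\{\lambda^C\}=\{\lambda'\}-\{\lambda\}+\{\lambda''\}$. For a Waldhausen category $\mathbf{C}$: a weak cofiber sequence is a diagram $A\rightarrowtail B\twoheadrightarrow C_1\xleftarrow{\sim}C$ given by a cofiber sequence followed by a weak equivalence in the opposite direction. A pair of weak cofiber sequences $\lambda$ consists of two weak cofiber sequences $\lambda_i=(A\xrightarrow{j_i}B\xrightarrow{r_i}C_i\xleftarrow{w_i}C)$, $i=1,2$, with $A,B,C$ in common. $K_1^{\mathrm{wcs}}\,\mathbf{C}$ is the abelian group generated by the pairs of weak cofiber sequences (the generator of $\lambda$ is denoted $\{\lambda\}$) modulo: (S2) $\{\lambda\}=0$ if $\lambda_1=\lambda_2$, i.e. $C_1=C_2$, $j_1=j_2$, $r_1=r_2$, $w_1=w_2$. (S1) $\{\lambda^A\}-\{\lambda^B\}+\{\lambda^C\}=\{\lambda'\}-\{\lambda\}+\{\lambda''\}$ for any six pairs of weak cofiber sequences, given for $i=1,2$ by $\lambda^A: A'\xrightarrow{j^A_i}A\xrightarrow{r^A_i}A''_i\xleftarrow{w^A_i}A''$; $\lambda^B: B'\xrightarrow{j^B_i}B\xrightarrow{r^B_i}B''_i\xleftarrow{w^B_i}B''$; $\lambda^C: C'\xrightarrow{j^C_i}C\xrightarrow{r^C_i}\check C''_i\xleftarrow{w^C_i}C''$; $\lambda': A'\xrightarrow{j'_i}B'\xrightarrow{r'_i}C'_i\xleftarrow{w'_i}C'$; $\lambda: A\xrightarrow{j_i}B\xrightarrow{r_i}C_i\xleftarrow{w_i}C$;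 $\lambda'': A''\xrightarrow{j''_i}B''\xrightarrow{r''_i}\hat C''_i\xleftarrow{w''_i}C''$, such that for each $i$ there exist weak cofiber sequences $A''_i\xrightarrow{\check\jmath_i}B''_i\xrightarrow{\check r_i}C''_i\xleftarrow{\check w_i}\check C''_i$ and $C'_i\xrightarrow{\hat\jmath_i}C_i\xrightarrow{\hat r_i}C''_i\xleftarrow{\hat w_i}\hat C''_i$ with $j_ij^A_i=j^B_ij'_i$, $\check\jmath_ir^A_i=r^B_ij_i$, $\check\jmath_iw^A_i=w^B_ij''_i$, $\hat\jmath_ir'_i=r_ij^B_i$, $\hat r_ir_i=\check r_ir^B_i$, $\hat w_ir''_i=\check r_iw^B_i$, $w_ij^C_i=\hat\jmath_iw'_i$, $\check w_ir^C_i=\hat r_iw_i$, $\check w_iw^C_i=\hat w_iw''_i$. *)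

(* Defs.v *)
From HB Require Import structures.
From mathcomp Require Import all_boot all_algebra.
From mathcomp Require Import generic_quotient ring_quotient.
From mathcomp Require Import boolp.
From mathcomp Require Import freeg.

Set Implicit Arguments.
Unset Strict Implicit.
Unset Printing Implicit Defensive.

Import GRing.Theory.
Local Open Scope ring_scope.
Local Open Scope quotient_scope.

Section Presentation.
Variables (G : Type) (R : {freeg {classic G} / int} -> Prop).

Definition in_relator_span (x : {freeg {classic G} / int}) : bool :=
  `[< forall S : zmodClosed {freeg {classic G} / int},
          (forall r, R r -> r \in S) -> x \in S >].

Lemma in_relator_span_zmod_closed : zmod_closed in_relator_span.
Proof.
split=> [|x y /asboolP xS /asboolP yS]; apply/asboolP => S RS.
  exact: rpred0.
by rewrite rpredB ?xS ?yS.
Qed.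

Definition relator_span : zmodClosed {freeg {classic G} / int} :=
  HB.pack in_relator_span
    (GRing.isZmodClosed.Build _ in_relator_span in_relator_span_zmod_closed).

Lemma mem_relator_span r : R r -> r \in relator_span.
Proof. by move=> Rr; apply/asboolP => S; apply. Qed.

Definition presented : zmodType :=
  Quotient.quot relator_span.

Definition pclass (x : {freeg {classic G} / int}) : presented :=
  \pi_(Quotient.quot relator_span) x.

Lemma pclass_additive : zmod_morphism pclass.
Proof. exact: (raddfB (\pi_(Quotient.quot relator_span))). Qed.
HB.instance Definition _ :=
  GRing.isZmodMorphism.Build _ _ pclass pclass_additive.

Lemma pclass_eq x y : (pclass x == pclass y) = (x - y \in relator_span).
Proof. by rewrite Quotient.idealrBE. Qed.

Lemma pclass_relator r : R r -> pclass r = 0.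
Proof.
move=> Rr; apply/eqP.
by rewrite -(raddf0 pclass) pclass_eq subr0 mem_relator_span.
Qed.

Lemma pclassP (x : presented) : exists y, x = pclass y.
Proof. by exists (repr x); rewrite /pclass reprK. Qed.

Definition free_gen (g : G) : {freeg {classic G} / int} :=
  << (g : {classic G}) >>.

Definition pgen (g : G) : presented := pclass (free_gen g).

Section Lift.
Variables (M : zmodType) (f : G -> M).

(* fglift only targets modules over the coefficient ring int, hence the
   Z-module structure on the alias zmodule M. *)
Definition free_lift (x : {freeg {classic G} / int}) : M :=
  fglift (f : {classic G} -> zmodule M) x.

Lemma free_lift_additive : zmod_morphism free_lift.
Proof. move=> x y; exact: (@lift_is_additive int {classic G} (zmodule M) f x y). Qed.
HB.instance Definition _ :=
  GRing.isZmodMorphism.Build _ _ free_lift free_lift_additive.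

Lemma free_lift_gen g : free_lift (free_gen g) = f g.
Proof. by rewrite /free_lift liftU scale1r. Qed.

(* The map induced by f, meaningful when f kills the relators. *)
Definition pres_lift (x : presented) : M := free_lift (repr x).

Hypothesis fR : forall r, R r -> free_lift r = 0.

Let in_ker (x : {freeg {classic G} / int}) : bool := free_lift x == 0.

Let in_ker_zmod_closed : zmod_closed in_ker.
Proof.
split=> [|x y]; rewrite !unfold_in /in_ker ?raddf0 // => /eqP xK /eqP yK.
by rewrite raddfB /= xK yK subrr.
Qed.

Lemma pres_liftE x : pres_lift (pclass x) = free_lift x.
Proof.
pose K : zmodClosed {freeg {classic G} / int} :=
  HB.pack in_ker (GRing.isZmodClosed.Build _ in_ker in_ker_zmod_closed).
apply/eqP; rewrite -subr_eq0 -raddfB.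
have /asboolP/(_ K)H : repr (pclass x) - x \in relator_span.
  by rewrite -pclass_eq /pclass reprK.
by apply: H => r Rr; rewrite unfold_in; apply/eqP/fR.
Qed.

Lemma pres_lift_additive : zmod_morphism pres_lift.
Proof.
move=> x y; have [[x' ->] [y' ->]] := (pclassP x, pclassP y).
by rewrite -raddfB !pres_liftE raddfB.
Qed.

Lemma pres_lift_gen g : pres_lift (pgen g) = f g.
Proof. by rewrite pres_liftE free_lift_gen. Qed.

End Lift.
End Presentation.

Declare Scope cat_scope.
Delimit Scope cat_scope with cat.
Local Open Scope cat_scope.
Reserved Notation "g ∘ f" (at level 40, left associativity).
Reserved Notation "A ~> B" (at level 70, no associativity).

Record category := Category {
  ob :> Type;
  hom : ob -> ob -> Type;
  idm : forall A, hom A A;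
  mcomp : forall A B C, hom B C -> hom A B -> hom A C;
  mcompA : forall A B C D (h : hom C D) (g : hom B C) (f : hom A B),
    mcomp h (mcomp g f) = mcomp (mcomp h g) f;
  comp1m : forall A B (f : hom A B), mcomp (idm B) f = f;
  compm1 : forall A B (f : hom A B), mcomp f (idm A) = f;
}.
Arguments hom {c} A B.
Arguments idm {c} A : simpl never.
Arguments mcomp {c A B C} g f : simpl never.
Arguments mcompA {c A B C D} h g f.
Arguments comp1m {c A B} f.
Arguments compm1 {c A B} f.
Notation "A ~> B" := (hom A B) : cat_scope.
Notation "g ∘ f" := (mcomp g f) : cat_scope.

Section CategoryNotions.
Variable C : category.
Implicit Types A B D X Y : C.

Definition is_iso A B (f : A ~> B) : Prop :=
  exists g : B ~> A, g ∘ f = idm A /\ f ∘ g = idm B.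

Definition is_zero_object Z : Prop :=
  forall A, (exists! f : Z ~> A, True) /\ (exists! f : A ~> Z, True).

(*   A --f--> B
     |g       |i
     X --k--> Y   *)
Definition is_pushout A B X Y
    (f : A ~> B) (g : A ~> X) (i : B ~> Y) (k : X ~> Y) : Prop :=
  i ∘ f = k ∘ g /\
  forall T (u : B ~> T) (v : X ~> T), u ∘ f = v ∘ g ->
    exists! h : Y ~> T, h ∘ i = u /\ h ∘ k = v.

(*   Y --k--> X
     |i       |g
     B --f--> A   *)
Definition is_pullback A B X Y
    (f : B ~> A) (g : X ~> A) (i : Y ~> B) (k : Y ~> X) : Prop :=
  f ∘ i = g ∘ k /\
  forall T (u : T ~> B) (v : T ~> X), f ∘ u = g ∘ v ->
    exists! h : T ~> Y, i ∘ h = u /\ k ∘ h = v.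

End CategoryNotions.

Record functor (C D : category) := Functor {
  fun_ob :> C -> D;
  fun_hom : forall A B : C, A ~> B -> fun_ob A ~> fun_ob B;
  fun_id : forall A : C, fun_hom (idm A) = idm (fun_ob A);
  fun_comp : forall (A B X : C) (g : B ~> X) (f : A ~> B),
    fun_hom (g ∘ f) = fun_hom g ∘ fun_hom f;
}.
Arguments fun_hom {C D} _ {A B} _.

Lemma fun_iso (C D : category) (F : functor C D) (A B : C) (f : A ~> B) :
  is_iso f -> is_iso (fun_hom F f).
Proof.
by case=> g [gf fg]; exists (fun_hom F g); rewrite -!fun_comp gf fg !fun_id.
Qed.

Record waldhausen := Waldhausen {
  wcat :> category;
  wzero : wcat;
  wzeroP : is_zero_object wzero;
  cofib : forall A B : wcat, A ~> B -> Prop;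
  weq : forall A B : wcat, A ~> B -> Prop;
  cofib_iso : forall (A B : wcat) (f : A ~> B), is_iso f -> cofib f;
  cofib_comp : forall (A B X : wcat) (g : B ~> X) (f : A ~> B),
    cofib g -> cofib f -> cofib (g ∘ f);
  cofib_zero : forall (A : wcat) (f : wzero ~> A), cofib f;
  pushout_ex : forall (A B X : wcat) (f : A ~> B) (g : A ~> X), cofib f ->
    exists (Y : wcat) (i : B ~> Y) (k : X ~> Y), is_pushout f g i k;
  cofib_pushout : forall (A B X Y : wcat)
      (f : A ~> B) (g : A ~> X) (i : B ~> Y) (k : X ~> Y),
    cofib f -> is_pushout f g i k -> cofib k;
  weq_iso : forall (A B : wcat) (f : A ~> B), is_iso f -> weq f;
  weq_comp : forall (A B X : wcat) (g : B ~> X) (f : A ~> B),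
    weq g -> weq f -> weq (g ∘ f);
  weq_gluing : forall (A B X Y A' B' X' Y' : wcat)
      (f : A ~> B) (g : A ~> X) (i : B ~> Y) (k : X ~> Y)
      (f' : A' ~> B') (g' : A' ~> X') (i' : B' ~> Y') (k' : X' ~> Y')
      (a : A ~> A') (b : B ~> B') (x : X ~> X') (y : Y ~> Y'),
    cofib f -> cofib f' -> is_pushout f g i k -> is_pushout f' g' i' k' ->
    b ∘ f = f' ∘ a -> x ∘ g = g' ∘ a -> y ∘ i = i' ∘ b -> y ∘ k = k' ∘ x ->
    weq a -> weq b -> weq x -> weq y;
}.
Arguments cofib {w A B}.
Arguments weq {w A B}.

(* A >-> B ->> Q is a cofiber sequence when Q is the pushout of * <- A >-> B. *)
Definition is_cofiber_seq (C : waldhausen) (A B Q : C)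
    (j : A ~> B) (r : B ~> Q) : Prop :=
  cofib j /\ exists (t : A ~> wzero C) (s : wzero C ~> Q), is_pushout j t r s.

Record cofiber_seq (C : waldhausen) (A B Q : C) := CofiberSeq {
  cs_j : A ~> B;
  cs_r : B ~> Q;
  cs_P : is_cofiber_seq cs_j cs_r;
}.

Record weak_cofiber_seq (C : waldhausen) (A B Q : C) := WeakCofiberSeq {
  wcs_Q1 : C;
  wcs_seq :> cofiber_seq A B wcs_Q1;
  wcs_w : Q ~> wcs_Q1;
  wcs_weq : weq wcs_w;
}.

Record wcs_pair (C : waldhausen) := WcsPair {
  wp_A : C;
  wp_B : C;
  wp_Q : C;
  wp1 : weak_cofiber_seq wp_A wp_B wp_Q;
  wp2 : weak_cofiber_seq wp_A wp_B wp_Q;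
}.
Arguments WcsPair {C wp_A wp_B wp_Q} wp1 wp2.

Section K1wcs.
Variable C : waldhausen.

(* One of the two halves i = 1, 2 of the hypothesis of the six-term relation.
   The objects wcs_Q1 lA, wcs_Q1 lB, wcs_Q1 lC, wcs_Q1 l', wcs_Q1 l, wcs_Q1 l''
   are usually written A''_i, B''_i, check C''_i, C'_i, C_i, hat C''_i; the two
   auxiliary weak cofiber sequences (chk, wchk) and (hat, what) are unbundled
   because they share the object Q2 = C''_i. *)
Definition S1_compatible (A' A A'' B' B B'' C' C0 C'' : C)
    (lA : weak_cofiber_seq A' A A'') (lB : weak_cofiber_seq B' B B'')
    (lC : weak_cofiber_seq C' C0 C'') (l' : weak_cofiber_seq A' B' C')
    (l : weak_cofiber_seq A B C0) (l'' : weak_cofiber_seq A'' B'' C'') : Prop :=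
  exists (Q2 : C)
    (chk : cofiber_seq (wcs_Q1 lA) (wcs_Q1 lB) Q2) (wchk : wcs_Q1 lC ~> Q2)
    (hat : cofiber_seq (wcs_Q1 l') (wcs_Q1 l) Q2) (what : wcs_Q1 l'' ~> Q2),
    [/\ weq wchk, weq what &
     [/\ cs_j l ∘ cs_j lA = cs_j lB ∘ cs_j l',
         cs_j chk ∘ cs_r lA = cs_r lB ∘ cs_j l &
         cs_j chk ∘ wcs_w lA = wcs_w lB ∘ cs_j l''] /\
     [/\ cs_j hat ∘ cs_r l' = cs_r l ∘ cs_j lB,
         cs_r hat ∘ cs_r l = cs_r chk ∘ cs_r lB &
         what ∘ cs_r l'' = cs_r chk ∘ wcs_w lB] /\
     [/\ wcs_w l ∘ cs_j lC = cs_j hat ∘ wcs_w l',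
         wchk ∘ cs_r lC = cs_r hat ∘ wcs_w l &
         wchk ∘ wcs_w lC = what ∘ wcs_w l'']].

Local Notation "{| a , b |}" := (free_gen (WcsPair a b)).

Inductive K1wcs_relator : {freeg {classic (wcs_pair C)} / int} -> Prop :=
| K1wcs_S2 (A B Q : C) (l : weak_cofiber_seq A B Q) : K1wcs_relator {| l, l |}
| K1wcs_S1 (A' A A'' B' B B'' C' C0 C'' : C)
    (lA1 lA2 : weak_cofiber_seq A' A A'') (lB1 lB2 : weak_cofiber_seq B' B B'')
    (lC1 lC2 : weak_cofiber_seq C' C0 C'') (l'1 l'2 : weak_cofiber_seq A' B' C')
    (l1 l2 : weak_cofiber_seq A B C0) (l''1 l''2 : weak_cofiber_seq A'' B'' C'') :
    S1_compatible lA1 lB1 lC1 l'1 l1 l''1 ->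
    S1_compatible lA2 lB2 lC2 l'2 l2 l''2 ->
    K1wcs_relator (({|lA1, lA2|} - {|lB1, lB2|} + {|lC1, lC2|})
                 - ({|l'1, l'2|} - {|l1, l2|} + {|l''1, l''2|})).

Definition K1wcs : zmodType := presented K1wcs_relator.

End K1wcs.

(* Preserving cofiber sequences and weak equivalences is the part of exactness
   of a functor of Waldhausen categories on which K1wcs depends. *)
Record wfunctor (C D : waldhausen) := WFunctor {
  wfun :> functor C D;
  wfun_cofiber : forall (A B Q : C) (j : A ~> B) (r : B ~> Q),
    is_cofiber_seq j r -> is_cofiber_seq (fun_hom wfun j) (fun_hom wfun r);
  wfun_weq : forall (A B : C) (f : A ~> B), weq f -> weq (fun_hom wfun f);
}.

Section K1wcsMap.
Variables (C D : waldhausen) (F : wfunctor C D).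

Definition cofiber_seq_map (A B Q : C) (l : cofiber_seq A B Q) :
    cofiber_seq (F A) (F B) (F Q) :=
  CofiberSeq (wfun_cofiber F (cs_P l)).

Definition wcs_map (A B Q : C) (l : weak_cofiber_seq A B Q) :
    weak_cofiber_seq (F A) (F B) (F Q) :=
  WeakCofiberSeq (cofiber_seq_map l) (wfun_weq F (wcs_weq l)).

Definition wcs_pair_map (p : wcs_pair C) : wcs_pair D :=
  WcsPair (wcs_map (wp1 p)) (wcs_map (wp2 p)).

Lemma S1_compatible_map (A' A A'' B' B B'' C' C0 C'' : C)
    (lA : weak_cofiber_seq A' A A'') (lB : weak_cofiber_seq B' B B'')
    (lC : weak_cofiber_seq C' C0 C'') (l' : weak_cofiber_seq A' B' C')
    (l : weak_cofiber_seq A B C0) (l'' : weak_cofiber_seq A'' B'' C'') :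
  S1_compatible lA lB lC l' l l'' ->
  S1_compatible (wcs_map lA) (wcs_map lB) (wcs_map lC)
                (wcs_map l') (wcs_map l) (wcs_map l'').
Proof.
case=> Q2 [chk [wchk [hat [what]]]].
case=> wc wh [[e1 e2 e3] [[e4 e5 e6] [e7 e8 e9]]].
exists (F Q2), (cofiber_seq_map chk), (fun_hom F wchk),
  (cofiber_seq_map hat), (fun_hom F what).
split; [exact: wfun_weq | exact: wfun_weq |].
by split; [|split]; split; rewrite /= -!fun_comp; congr (fun_hom F).
Qed.

Definition K1wcs_map : K1wcs C -> K1wcs D :=
  pres_lift (fun p => pgen (@K1wcs_relator D) (wcs_pair_map p)).

Lemma K1wcs_map_relator r : @K1wcs_relator C r ->
  free_lift (fun p => pgen (@K1wcs_relator D) (wcs_pair_map p)) r = 0.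
Proof.
case=> [A B Q l|A' A A'' B' B B'' C' C0 C'' lA1 lA2 lB1 lB2 lC1 lC2].
  rewrite free_lift_gen /=; apply: pclass_relator; exact: K1wcs_S2.
move=> l'1 l'2 l1 l2 l''1 l''2 H1 H2.
rewrite !(raddfB (free_lift _), raddfD (free_lift _)) /= !free_lift_gen /pgen.
rewrite -!(raddfB (pclass _), raddfD (pclass _)).
apply: pclass_relator; exact: K1wcs_S1 (S1_compatible_map H1) (S1_compatible_map H2).
Qed.

Lemma K1wcs_map_gen p :
  K1wcs_map (pgen _ p) = pgen (@K1wcs_relator D) (wcs_pair_map p).
Proof. exact/pres_lift_gen/K1wcs_map_relator. Qed.

Lemma K1wcs_map_additive : zmod_morphism K1wcs_map.
Proof. exact/pres_lift_additive/K1wcs_map_relator. Qed.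
HB.instance Definition _ :=
  GRing.isZmodMorphism.Build _ _ K1wcs_map K1wcs_map_additive.

End K1wcsMap.

Record preadditive := Preadditive {
  pob : Type;
  phom : pob -> pob -> zmodType;
  pid : forall A, phom A A;
  pcomp : forall A B C, phom B C -> phom A B -> phom A C;
  pcompA : forall A B C D (h : phom C D) (g : phom B C) (f : phom A B),
    pcomp h (pcomp g f) = pcomp (pcomp h g) f;
  pcomp1m : forall A B (f : phom A B), pcomp (pid B) f = f;
  pcompm1 : forall A B (f : phom A B), pcomp f (pid A) = f;
  pcompDl : forall A B C (g g' : phom B C) (f : phom A B),
    pcomp (g + g') f = pcomp g f + pcomp g' f;
  pcompDr : forall A B C (g : phom B C) (f f' : phom A B),
    pcomp g (f + f') = pcomp g f + pcomp g f';
}.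

Definition category_of (P : preadditive) : category :=
  Category (@pcompA P) (@pcomp1m P) (@pcompm1 P).
Coercion category_of : preadditive >-> category.

(* The hom-sets of category_of P are only convertible to those of P, on which
   the group structure lives. *)
HB.instance Definition _ (P : preadditive) (A B : P) :=
  GRing.Zmodule.copy (@hom (category_of P) A B) (@phom P A B).

Section PreadditiveNotions.
Variable P : preadditive.

Definition is_kernel (A B Q : P) (r : B ~> Q) (j : A ~> B) : Prop :=
  r ∘ j = 0 /\
  forall T (u : T ~> B), r ∘ u = 0 -> exists! h : T ~> A, j ∘ h = u.

Definition is_cokernel (A B Q : P) (j : A ~> B) (r : B ~> Q) : Prop :=
  r ∘ j = 0 /\
  forall T (u : B ~> T), u ∘ j = 0 -> exists! h : Q ~> T, h ∘ r = u.

Definition is_biproduct (A B S : P)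
    (i1 : A ~> S) (i2 : B ~> S) (p1 : S ~> A) (p2 : S ~> B) : Prop :=
  [/\ p1 ∘ i1 = idm A, p2 ∘ i2 = idm B, p1 ∘ i2 = 0, p2 ∘ i1 = 0 &
      i1 ∘ p1 + i2 ∘ p2 = idm S].

End PreadditiveNotions.

Record additive_category := AdditiveCategory {
  apre :> preadditive;
  azero : apre;
  azeroP : is_zero_object azero;
  biproduct_ex : forall A B : apre,
    exists (S : apre) (i1 : A ~> S) (i2 : B ~> S) (p1 : S ~> A) (p2 : S ~> B),
      is_biproduct i1 i2 p1 p2;
}.

Section ExactStructure.
Variables (M : additive_category)
  (ses : forall A B C : M, A ~> B -> B ~> C -> Prop).

Definition is_adm_mono (A B : M) (j : A ~> B) : Prop :=
  exists (C : M) (r : B ~> C), ses j r.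
Definition is_adm_epi (B C : M) (r : B ~> C) : Prop :=
  exists (A : M) (j : A ~> B), ses j r.

(* Quillen's axioms a), b), c), in this order (Higher algebraic K-theory I,
   section 2); c) is known to be redundant (Keller). *)
Record is_exact_structure : Prop := IsExactStructure {
  ses_iso : forall (A B C A' B' C' : M) (j : A ~> B) (r : B ~> C)
      (j' : A' ~> B') (r' : B' ~> C')
      (a : A ~> A') (b : B ~> B') (c : C ~> C'),
    is_iso a -> is_iso b -> is_iso c ->
    b ∘ j = j' ∘ a -> c ∘ r = r' ∘ b -> ses j r -> ses j' r';
  ses_split : forall (A C S : M)
      (i1 : A ~> S) (i2 : C ~> S) (p1 : S ~> A) (p2 : S ~> C),
    is_biproduct i1 i2 p1 p2 -> ses i1 p2;
  ses_kernel : forall (A B C : M) (j : A ~> B) (r : B ~> C),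
    ses j r -> is_kernel r j;
  ses_cokernel : forall (A B C : M) (j : A ~> B) (r : B ~> C),
    ses j r -> is_cokernel j r;
  adm_epi_comp : forall (A B C : M) (g : B ~> C) (f : A ~> B),
    is_adm_epi g -> is_adm_epi f -> is_adm_epi (g ∘ f);
  adm_epi_pullback : forall (B C X : M) (r : B ~> C) (f : X ~> C),
    is_adm_epi r -> exists (Y : M) (i : Y ~> B) (k : Y ~> X),
      is_pullback r f i k /\ is_adm_epi k;
  adm_mono_comp : forall (A B C : M) (g : B ~> C) (f : A ~> B),
    is_adm_mono g -> is_adm_mono f -> is_adm_mono (g ∘ f);
  adm_mono_pushout : forall (A B X : M) (j : A ~> B) (f : A ~> X),
    is_adm_mono j -> exists (Y : M) (i : B ~> Y) (k : X ~> Y),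
      is_pushout j f i k /\ is_adm_mono k;
  adm_epi_cancel : forall (A B C : M) (g : B ~> C) (f : A ~> B),
    (exists (K : M) (k : K ~> B), is_kernel g k) ->
    is_adm_epi (g ∘ f) -> is_adm_epi g;
  adm_mono_cancel : forall (A B C : M) (g : B ~> C) (f : A ~> B),
    (exists (Q : M) (q : B ~> Q), is_cokernel f q) ->
    is_adm_mono (g ∘ f) -> is_adm_mono f;
}.
End ExactStructure.

Record exact_category := ExactCategory {
  eadd :> additive_category;
  ses : forall A B C : eadd, A ~> B -> B ~> C -> Prop;
  exactP : is_exact_structure ses;
}.
Arguments ses {e A B C} j r.

Record exact_functor (E E' : exact_category) := ExactFunctor {
  efun :> functor E E';
  efunD : forall (A B : E) (f g : A ~> B),
    fun_hom efun (f + g) = fun_hom efun f + fun_hom efun g;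
  efun_ses : forall (A B C : E) (j : A ~> B) (r : B ~> C),
    ses j r -> ses (fun_hom efun j) (fun_hom efun r);
}.

Section CategoryLemmas.
Variable C : category.
Implicit Types A B D X Y : C.

Lemma iso_id A : is_iso (idm A).
Proof. by exists (idm A); rewrite comp1m. Qed.

Lemma iso_comp A B D (g : B ~> D) (f : A ~> B) :
  is_iso g -> is_iso f -> is_iso (g ∘ f).
Proof.
case=> g' [g'g gg'] [f' [f'f ff']]; exists (f' ∘ g'); split.
  by rewrite mcompA -(mcompA f') g'g compm1.
by rewrite mcompA -(mcompA g) ff' compm1.
Qed.

Lemma pushout_eq A B X Y (f : A ~> B) (g : A ~> X) (i : B ~> Y) (k : X ~> Y)
    T (h h' : Y ~> T) :
  is_pushout f g i k -> h ∘ i = h' ∘ i -> h ∘ k = h' ∘ k -> h = h'.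
Proof.
case=> sq univ ei ek; have [|h0 [_ uniq_h0]] := univ T (h ∘ i) (h ∘ k).
  by rewrite -!mcompA sq.
by rewrite -(uniq_h0 h) // -(uniq_h0 h').
Qed.

Lemma pushout_iso A B X Y A' B' X' Y'
    (f : A ~> B) (g : A ~> X) (i : B ~> Y) (k : X ~> Y)
    (f' : A' ~> B') (g' : A' ~> X') (i' : B' ~> Y') (k' : X' ~> Y')
    (a : A ~> A') (b : B ~> B') (x : X ~> X') (y : Y ~> Y') :
  is_pushout f g i k -> is_pushout f' g' i' k' ->
  b ∘ f = f' ∘ a -> x ∘ g = g' ∘ a -> y ∘ i = i' ∘ b -> y ∘ k = k' ∘ x ->
  is_iso a -> is_iso b -> is_iso x -> is_iso y.
Proof.
move=> po po' ef eg ei ek [a' [a'a aa']] [b' [b'b bb']] [x' [x'x xx']].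
have [|h [[hi hk] _]] := po'.2 _ (i ∘ b') (k ∘ x').
  have ef' : b' ∘ f' = f ∘ a'.
    by rewrite -(compm1 (b' ∘ f')) -aa' mcompA -(mcompA b') -ef !mcompA b'b comp1m.
  have eg' : x' ∘ g' = g ∘ a'.
    by rewrite -(compm1 (x' ∘ g')) -aa' mcompA -(mcompA x') -eg !mcompA x'x comp1m.
  by rewrite -!mcompA ef' eg' !mcompA po.1.
exists h; split.
  apply: (pushout_eq po); rewrite comp1m -mcompA.
    by rewrite ei mcompA hi -mcompA b'b compm1.
  by rewrite ek mcompA hk -mcompA x'x compm1.
apply: (pushout_eq po'); rewrite comp1m -mcompA.
  by rewrite hi mcompA ei -mcompA bb' compm1.
by rewrite hk mcompA ek -mcompA xx' compm1.
Qed.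

Lemma pushout_unique A B X Y Y' (f : A ~> B) (g : A ~> X)
    (i : B ~> Y) (k : X ~> Y) (i' : B ~> Y') (k' : X ~> Y') :
  is_pushout f g i k -> is_pushout f g i' k' ->
  exists y : Y ~> Y', [/\ is_iso y, y ∘ i = i' & y ∘ k = k'].
Proof.
move=> po po'; have [y [[yi yk] _]] := po.2 _ i' k' po'.1.
exists y; split=> //.
by apply: (pushout_iso po po' (a := idm A) (b := idm B) (x := idm X));
  rewrite ?comp1m ?compm1 //; apply: iso_id.
Qed.

End CategoryLemmas.

Section ExactWaldhausen.
Variable E : exact_category.
Implicit Types A B Q X Y : E.
Let Z : E := azero E.

Lemma compDl A B Q (g g' : B ~> Q) (f : A ~> B) :
  (g + g') ∘ f = g ∘ f + g' ∘ f.
Proof. exact: pcompDl. Qed.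

Lemma compDr A B Q (g : B ~> Q) (f f' : A ~> B) :
  g ∘ (f + f') = g ∘ f + g ∘ f'.
Proof. exact: pcompDr. Qed.

Lemma comp0m A B Q (f : A ~> B) : (0 : B ~> Q) ∘ f = 0.
Proof. by apply: (addrI (0 ∘ f)); rewrite -compDl !addr0. Qed.

Lemma compm0 A B Q (g : B ~> Q) : g ∘ (0 : A ~> B) = 0.
Proof. by apply: (addrI (g ∘ 0)); rewrite -compDr !addr0. Qed.

Lemma from_zero0 A (f : Z ~> A) : f = 0.
Proof.
have [[u [_ uu]] _] := azeroP A.
by rewrite -(uu f) // -(uu 0).
Qed.

Lemma to_zero0 A (f : A ~> Z) : f = 0.
Proof.
have [_ [u [_ uu]]] := azeroP A.
by rewrite -(uu f) // -(uu 0).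
Qed.

Lemma ses_idl A (f : Z ~> A) : ses f (idm A).
Proof.
apply: (ses_split (exactP E) (i2 := idm A) (p1 := 0)).
split; rewrite ?comp1m ?compm1 ?comp0m ?compm0 ?(from_zero0 f) ?add0r //.
by rewrite (from_zero0 (idm Z)).
Qed.

Lemma ses_idr A (f : A ~> Z) : ses (idm A) f.
Proof.
apply: (ses_split (exactP E) (i2 := 0) (p1 := idm A)).
split; rewrite ?comp1m ?compm1 ?comp0m ?compm0 ?(to_zero0 f) ?addr0 //.
by rewrite (to_zero0 (idm Z)).
Qed.

Lemma adm_mono_iso A B (f : A ~> B) :
  is_iso f -> is_adm_mono (@ses E) f.
Proof.
move=> f_iso; exists Z, 0.
apply: (ses_iso (exactP E) (a := idm A) (b := f) (c := idm Z))
  (ses_idr (0 : A ~> Z)) => //; try exact: iso_id.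
by rewrite comp0m compm0.
Qed.

Lemma cokernel_pushout A B Q (j : A ~> B) (r : B ~> Q)
    (t : A ~> Z) (s : Z ~> Q) :
  is_cokernel j r <-> is_pushout j t r s.
Proof.
rewrite (to_zero0 t) (from_zero0 s); split=> -[rj univ]; split.
- by rewrite rj compm0.
- move=> T u v; rewrite compm0 => /univ[h [hr uh]].
  exists h; split=> [|h' [/uh //]].
  by rewrite compm0 (from_zero0 v).
- by rewrite rj compm0.
- move=> T u uj; have [|h [[hr _] uh]] := univ T u 0; first by rewrite uj compm0.
  by exists h; split=> // h' h'r; apply: uh; rewrite compm0.
Qed.

Lemma adm_mono_pushout_any A B X Y
    (f : A ~> B) (g : A ~> X) (i : B ~> Y) (k : X ~> Y) :
  is_adm_mono (@ses E) f -> is_pushout f g i k -> is_adm_mono (@ses E) k.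
Proof.
move=> fM po.
have [Y' [i' [k' [po' k'M]]]] := adm_mono_pushout (exactP E) g fM.
have [y [y_iso _ <-]] := pushout_unique po' po.
by apply: (adm_mono_comp (exactP E)) k'M; apply: adm_mono_iso.
Qed.

(* Its cofiber sequences are the short exact sequences: see cofiber_seq_ses. *)
Definition waldhausen_of : waldhausen.
Proof.
refine (@Waldhausen E Z (@azeroP E)
  (fun A B f => is_adm_mono (@ses E) f) (fun A B f => is_iso f)
  adm_mono_iso _ _ _ adm_mono_pushout_any _ _ _).
- exact: adm_mono_comp (exactP E).
- by move=> A f; exists A, (idm A); apply: ses_idl.
- move=> A B X f g fM.
  have [Y [i [k [po _]]]] := adm_mono_pushout (exactP E) g fM.
  by exists Y, i, k.
- by [].
- by move=> A B X g f; apply: iso_comp.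
- move=> A B X Y A' B' X' Y' f g i k f' g' i' k' a b x y _ _.
  exact: pushout_iso.
Defined.

Lemma cofiber_seq_ses (A B Q : waldhausen_of) (j : A ~> B) (r : B ~> Q) :
  is_cofiber_seq j r <-> ses (e := E) j r.
Proof.
split=> [[[Q' [r' jr']] [t [s po]]]|jr].
  have po' := (cokernel_pushout j r' t 0).1 (ses_cokernel (exactP E) jr').
  have [y [y_iso yr' _]] := pushout_unique po' po.
  apply: (ses_iso (exactP E) (a := idm A) (b := idm B) (c := y)) jr' => //;
    rewrite ?comp1m ?compm1 //; exact: iso_id.
split; first by exists Q, r.
exists (0 : A ~> Z), (0 : Z ~> Q).
exact: (cokernel_pushout j r _ _).1 (ses_cokernel (exactP E) jr).
Qed.

End ExactWaldhausen.

Section ExactWFunctor.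
Variables (E E' : exact_category) (F : exact_functor E E').

Lemma exact_functor_cofiber (A B Q : waldhausen_of E) (j : A ~> B) (r : B ~> Q) :
  is_cofiber_seq j r ->
  is_cofiber_seq (C := waldhausen_of E') (fun_hom F j) (fun_hom F r).
Proof. by move=> /cofiber_seq_ses jr; apply/cofiber_seq_ses/efun_ses. Qed.

Definition wfunctor_of : wfunctor (waldhausen_of E) (waldhausen_of E') :=
  @WFunctor (waldhausen_of E) (waldhausen_of E') F
    exact_functor_cofiber (fun A B f => @fun_iso _ _ F A B f).

End ExactWFunctor.

Record short_exact (E : exact_category) (A B C : E) := ShortExact {
  se_j : A ~> B;
  se_r : B ~> C;
  se_P : ses se_j se_r;
}.

Record ses_pair (E : exact_category) := SesPair {
  sp_A : E;
  sp_B : E;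
  sp_C : E;
  sp1 : short_exact sp_A sp_B sp_C;
  sp2 : short_exact sp_A sp_B sp_C;
}.
Arguments SesPair {E sp_A sp_B sp_C} sp1 sp2.

Section NenashevD.
Variable E : exact_category.

(* Rows lA, lB, lC and columns l', l, l''. *)
Definition diagram33_commutes (A' A A'' B' B B'' C' C C'' : E)
    (lA : short_exact A' A A'') (lB : short_exact B' B B'')
    (lC : short_exact C' C C'') (l' : short_exact A' B' C')
    (l : short_exact A B C) (l'' : short_exact A'' B'' C'') : Prop :=
  [/\ se_j l ∘ se_j lA = se_j lB ∘ se_j l',
      se_j l'' ∘ se_r lA = se_r lB ∘ se_j l,
      se_r l ∘ se_j lB = se_j lC ∘ se_r l' &
      se_r l'' ∘ se_r lB = se_r lC ∘ se_r l].

Local Notation "{| a , b |}" := (free_gen (SesPair a b)).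

Inductive D_relator : {freeg {classic (ses_pair E)} / int} -> Prop :=
| D_diag (A B C : E) (l : short_exact A B C) : D_relator {| l, l |}
| D_33 (A' A A'' B' B B'' C' C C'' : E)
    (lA1 lA2 : short_exact A' A A'') (lB1 lB2 : short_exact B' B B'')
    (lC1 lC2 : short_exact C' C C'') (l'1 l'2 : short_exact A' B' C')
    (l1 l2 : short_exact A B C) (l''1 l''2 : short_exact A'' B'' C'') :
    diagram33_commutes lA1 lB1 lC1 l'1 l1 l''1 ->
    diagram33_commutes lA2 lB2 lC2 l'2 l2 l''2 ->
    D_relator (({|lA1, lA2|} - {|lB1, lB2|} + {|lC1, lC2|})
             - ({|l'1, l'2|} - {|l1, l2|} + {|l''1, l''2|})).

Definition D_group : zmodType := presented D_relator.

End NenashevD.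

Section DMap.
Variables (E E' : exact_category) (F : exact_functor E E').

Definition short_exact_map (A B C : E) (l : short_exact A B C) :
    short_exact (F A) (F B) (F C) :=
  ShortExact (efun_ses F (se_P l)).

Definition ses_pair_map (p : ses_pair E) : ses_pair E' :=
  SesPair (short_exact_map (sp1 p)) (short_exact_map (sp2 p)).

Lemma diagram33_map (A' A A'' B' B B'' C' C C'' : E)
    (lA : short_exact A' A A'') (lB : short_exact B' B B'')
    (lC : short_exact C' C C'') (l' : short_exact A' B' C')
    (l : short_exact A B C) (l'' : short_exact A'' B'' C'') :
  diagram33_commutes lA lB lC l' l l'' ->
  diagram33_commutes (short_exact_map lA) (short_exact_map lB)
    (short_exact_map lC) (short_exact_map l') (short_exact_map l)
    (short_exact_map l'').
Proof.
case=> e1 e2 e3 e4; split.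
- by move/(congr1 (fun_hom F)): e1; rewrite !fun_comp.
- by move/(congr1 (fun_hom F)): e2; rewrite !fun_comp.
- by move/(congr1 (fun_hom F)): e3; rewrite !fun_comp.
- by move/(congr1 (fun_hom F)): e4; rewrite !fun_comp.
Qed.

Definition D_map : D_group E -> D_group E' :=
  pres_lift (fun p => pgen (@D_relator E') (ses_pair_map p)).

Lemma D_map_relator r : @D_relator E r ->
  free_lift (fun p => pgen (@D_relator E') (ses_pair_map p)) r = 0.
Proof.
case=> [A B C l|A' A A'' B' B B'' C' C C'' lA1 lA2 lB1 lB2 lC1 lC2].
  rewrite free_lift_gen /=; apply: pclass_relator; exact: D_diag.
move=> l'1 l'2 l1 l2 l''1 l''2 H1 H2.
rewrite !(raddfB (free_lift _), raddfD (free_lift _)) /= !free_lift_gen /pgen.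
rewrite -!(raddfB (pclass _), raddfD (pclass _)).
apply: pclass_relator; exact: D_33 (diagram33_map H1) (diagram33_map H2).
Qed.

Lemma D_map_gen p :
  D_map (pgen _ p) = pgen (@D_relator E') (ses_pair_map p).
Proof. exact/pres_lift_gen/D_map_relator. Qed.

Lemma D_map_additive : zmod_morphism D_map.
Proof. exact/pres_lift_additive/D_map_relator. Qed.
HB.instance Definition _ :=
  GRing.isZmodMorphism.Build _ _ D_map D_map_additive.

End DMap.

(* Main.v *)
Require Import Defs.
From mathcomp Require Import all_boot all_algebra.
Import GRing.Theory.
From HB Require Import structures.
From mathcomp Require Import boolp freeg.

Set Implicit Arguments.
Unset Strict Implicit.
Unset Printing Implicit Defensive.

Local Open Scope ring_scope.
Local Open Scope cat_scope.

(** In an exact category the weak equivalences are the isomorphisms, so the last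
    arrow of a weak cofiber sequence A -> B -> Q1 <- Q carries no information up
    to isomorphism: absorbing it into the epimorphism gives a short exact
    sequence A -> B -> Q.  The isomorphism of the theorem sends a pair of short
    exact sequences to the pair of weak cofiber sequences having identities as
    weak equivalences ([wcs_of_ses]); its inverse absorbs the weak equivalences
    ([ses_of_wcs]).

    Both maps respect the relations.  A commutative 3x3 diagram of short exact
    sequences satisfies the compatibility condition of the six-term relation,
    its last row and column serving as auxiliary cofiber sequences
    ([S1_compatible_wcs_of_ses]).  Conversely, absorbing the weak equivalences
    of six compatible weak cofiber sequences yields a commutative 3x3 diagram,
    since every weak equivalence can be cancelled
    ([diagram33_ses_of_wcs]).

    One composite is the identity already on generators.  For the other, a pair
    of weak cofiber sequences and the pair obtained by absorbing the weak
    equivalences may be different generators, but have the same class: they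
    are two columns of an instance of the six-term relation whose first column
    is zero and whose three rows are pairs of equal sequences starting at the
    zero object ([S1_compatible_absorb]). *)

(** * Abelian groups given by generators and relations *)

(** An element of the free abelian group is an integer combination of
    generators, so additivity determines the maps from their values there. *)
Lemma presented_additive_ext (G : Type) (R : {freeg {classic G} / int} -> Prop)
    (M : zmodType) (f g : {additive presented R -> M}) :
  (forall x, f (pgen R x) = g (pgen R x)) -> f =1 g.
Proof.
move=> fg x; have [y ->] := pclassP x.
rewrite -[y]freeg_sumE !raddf_sum; apply: eq_bigr => z _.
rewrite -[coeff z y]intz -freegU_mulz !raddfMz; congr (_ *~ _).
exact: fg.
Qed.

(** * Short exact sequences as weak cofiber sequences *)

Section ExactCategory.
Variable E : exact_category.
Local Notation W := (waldhausen_of E).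

Lemma short_exact_eq (A B C : E) (l l' : short_exact A B C) :
  se_j l = se_j l' -> se_r l = se_r l' -> l = l'.
Proof.
case: l l' => [j r p] [j' r' p'] /= ej er; rewrite -ej -er in p' *.
by rewrite (Prop_irrelevance p p').
Qed.

Lemma wcs_eq (A B Q Q1 : W) (s s' : cofiber_seq A B Q1) (w w' : Q ~> Q1)
    (Hw : weq w) (Hw' : weq w') :
  cs_j s = cs_j s' -> cs_r s = cs_r s' -> w = w' ->
  WeakCofiberSeq s Hw = WeakCofiberSeq s' Hw'.
Proof.
case: s s' => [j r p] [j' r' p'] /= ej er ew.
rewrite -ej -er in p' *; rewrite -ew in Hw' *.
by rewrite (Prop_irrelevance p p') (Prop_irrelevance Hw Hw').
Qed.

Definition cofiber_seq_of_ses (A B C : E) (l : short_exact A B C) :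
    cofiber_seq (C := W) A B C :=
  CofiberSeq (C := W) ((cofiber_seq_ses (E := E) _ _).2 (se_P l)).

Definition wcs_of_ses (A B C : E) (l : short_exact A B C) :
    weak_cofiber_seq (C := W) A B C :=
  WeakCofiberSeq (cofiber_seq_of_ses l) (iso_id C : weq (w := W) (idm C)).

Definition wcs_pair_of_ses (p : ses_pair E) : wcs_pair W :=
  WcsPair (wcs_of_ses (sp1 p)) (wcs_of_ses (sp2 p)).

Lemma S1_compatible_wcs_of_ses (A' A A'' B' B B'' C' C C'' : E)
    (lA : short_exact A' A A'') (lB : short_exact B' B B'')
    (lC : short_exact C' C C'') (l' : short_exact A' B' C')
    (l : short_exact A B C) (l'' : short_exact A'' B'' C'') :
  diagram33_commutes lA lB lC l' l l'' ->
  S1_compatible (wcs_of_ses lA) (wcs_of_ses lB) (wcs_of_ses lC)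
    (wcs_of_ses l') (wcs_of_ses l) (wcs_of_ses l'').
Proof.
case=> e1 e2 e3 e4.
exists C'', (cofiber_seq_of_ses l''), (idm (C'' : W)),
  (cofiber_seq_of_ses lC), (idm (C'' : W)).
by split; [exact: iso_id | exact: iso_id |];
  split; [|split]; split; rewrite /= ?comp1m ?compm1.
Qed.

Definition D_to_K1 : D_group E -> K1wcs W :=
  pres_lift (fun p => pgen (@K1wcs_relator W) (wcs_pair_of_ses p)).

Lemma D_to_K1_relator r : @D_relator E r ->
  free_lift (fun p => pgen (@K1wcs_relator W) (wcs_pair_of_ses p)) r = 0.
Proof.
case=> [A B C l|A' A A'' B' B B'' C' C C'' lA1 lA2 lB1 lB2 lC1 lC2].
  by rewrite free_lift_gen; apply: pclass_relator; apply: K1wcs_S2.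
move=> l'1 l'2 l1 l2 l''1 l''2 H1 H2.
rewrite !(raddfB (free_lift _), raddfD (free_lift _)) /= !free_lift_gen /pgen.
rewrite -!(raddfB (pclass _), raddfD (pclass _)).
apply: pclass_relator.
exact: K1wcs_S1 (S1_compatible_wcs_of_ses H1) (S1_compatible_wcs_of_ses H2).
Qed.

Lemma D_to_K1_gen p :
  D_to_K1 (pgen _ p) = pgen (@K1wcs_relator W) (wcs_pair_of_ses p).
Proof. exact/pres_lift_gen/D_to_K1_relator. Qed.

Lemma D_to_K1_additive : zmod_morphism D_to_K1.
Proof. exact/pres_lift_additive/D_to_K1_relator. Qed.
HB.instance Definition _ :=
  GRing.isZmodMorphism.Build _ _ D_to_K1 D_to_K1_additive.

(** * Absorbing the weak equivalences *)

Lemma iso_mono (C : category) (A B X : C) (f : A ~> B) (u v : X ~> A) :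
  is_iso f -> f ∘ u = f ∘ v -> u = v.
Proof.
by case=> g [gf _] /(congr1 (mcomp g)); rewrite !mcompA gf !comp1m.
Qed.

Section Absorb.
Variables (A B Q : W) (l : weak_cofiber_seq A B Q).

Lemma ses_absorb_ex :
  exists2 r : B ~> Q, wcs_w l ∘ r = cs_r l & ses (e := E) (cs_j l) r.
Proof.
have [g [gw wg]] := wcs_weq l.
exists (g ∘ cs_r l); first by rewrite mcompA wg comp1m.
apply: (ses_iso (exactP E) (a := idm (A : E)) (b := idm (B : E)) (c := g)
  (j := cs_j l) (r := cs_r l)).
- exact: iso_id.
- exact: iso_id.
- by exists (wcs_w l).
- by rewrite comp1m compm1.
- by rewrite compm1.
- exact: (cofiber_seq_ses (E := E) _ _).1 (cs_P l).
Qed.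

(** This is w^-1 r.  Being an isomorphism only asserts that an inverse exists,
    so the composite is chosen rather than computed. *)
Definition wcs_epi : B ~> Q := s2val (cid2 ses_absorb_ex).

Lemma wcs_epiE : wcs_w l ∘ wcs_epi = cs_r l.
Proof. exact: (s2valP (cid2 ses_absorb_ex)). Qed.

Definition ses_of_wcs : short_exact (E := E) A B Q :=
  ShortExact (s2valP' (cid2 ses_absorb_ex)).

End Absorb.

Definition ses_pair_of_wcs (p : wcs_pair W) : ses_pair E :=
  SesPair (ses_of_wcs (wp1 p)) (ses_of_wcs (wp2 p)).

(** Each square involving an absorbed epimorphism w^-1 r is checked after
    composing with weak equivalences of its target, which are monic and restore
    the compatibility equations between the original sequences. *)
Lemma diagram33_ses_of_wcs (A' A A'' B' B B'' C' C C'' : W)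
    (lA : weak_cofiber_seq A' A A'') (lB : weak_cofiber_seq B' B B'')
    (lC : weak_cofiber_seq C' C C'') (l' : weak_cofiber_seq A' B' C')
    (l : weak_cofiber_seq A B C) (l'' : weak_cofiber_seq A'' B'' C'') :
  S1_compatible lA lB lC l' l l'' ->
  diagram33_commutes (ses_of_wcs lA) (ses_of_wcs lB) (ses_of_wcs lC)
    (ses_of_wcs l') (ses_of_wcs l) (ses_of_wcs l'').
Proof.
case=> Q2 [chk [wchk [hat [what]]]].
case=> wc wh [[e1 e2 e3] [[e4 e5 e6] [e7 e8 e9]]].
split; rewrite /=.
- exact: e1.
- apply: (iso_mono (wcs_weq lB)).
  by rewrite !mcompA wcs_epiE -e2 -e3 -mcompA wcs_epiE.
- apply: (iso_mono (wcs_weq l)).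
  by rewrite !mcompA wcs_epiE -e4 e7 -mcompA wcs_epiE.
apply: (iso_mono (wcs_weq l'')); apply: (iso_mono wh).
rewrite (mcompA (wcs_w l'')) wcs_epiE !(mcompA what) e6 -e9.
rewrite -(mcompA (cs_r chk)) wcs_epiE -e5.
by rewrite mcompA -(mcompA wchk) wcs_epiE e8 -(mcompA (cs_r hat)) wcs_epiE.
Qed.

Definition K1_to_D : K1wcs W -> D_group E :=
  pres_lift (fun p => pgen (@D_relator E) (ses_pair_of_wcs p)).

Lemma K1_to_D_relator r : @K1wcs_relator W r ->
  free_lift (fun p => pgen (@D_relator E) (ses_pair_of_wcs p)) r = 0.
Proof.
case=> [A B Q l|A' A A'' B' B B'' C' C C'' lA1 lA2 lB1 lB2 lC1 lC2].
  by rewrite free_lift_gen; apply: pclass_relator; apply: D_diag.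
move=> l'1 l'2 l1 l2 l''1 l''2 H1 H2.
rewrite !(raddfB (free_lift _), raddfD (free_lift _)) /= !free_lift_gen /pgen.
rewrite -!(raddfB (pclass _), raddfD (pclass _)).
apply: pclass_relator.
exact: D_33 (diagram33_ses_of_wcs H1) (diagram33_ses_of_wcs H2).
Qed.

Lemma K1_to_D_gen p :
  K1_to_D (pgen _ p) = pgen (@D_relator E) (ses_pair_of_wcs p).
Proof. exact/pres_lift_gen/K1_to_D_relator. Qed.

Lemma K1_to_D_additive : zmod_morphism K1_to_D.
Proof. exact/pres_lift_additive/K1_to_D_relator. Qed.
HB.instance Definition _ :=
  GRing.isZmodMorphism.Build _ _ K1_to_D K1_to_D_additive.

(** * The two maps are mutually inverse *)

Lemma wcs_of_sesK (A B C : E) (l : short_exact A B C) :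
  ses_of_wcs (wcs_of_ses l) = l.
Proof.
apply: short_exact_eq => //.
by rewrite -[RHS](wcs_epiE (wcs_of_ses l)) /= comp1m.
Qed.

Lemma D_to_K1K : cancel D_to_K1 K1_to_D.
Proof.
apply: (presented_additive_ext (f := K1_to_D \o D_to_K1) (g := idfun)) => p /=.
rewrite D_to_K1_gen K1_to_D_gen; congr (pgen _ _).
by case: p => A B C l1 l2; rewrite /ses_pair_of_wcs /= !wcs_of_sesK.
Qed.

Definition wcs_zero (A : E) : weak_cofiber_seq (C := W) (azero E) A A :=
  wcs_of_ses (ShortExact (ses_idl (0 : azero E ~> A))).

(** With the rows starting at zero, the six-term relation identifies its last
    two columns.  The auxiliary object is the third object of the cofiber
    sequence of [l]: the weak equivalence of [l] maps into it from the ends of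
    both the last row and the absorbed column, whence the compatibility. *)
Lemma S1_compatible_absorb (A B Q : W) (l : weak_cofiber_seq A B Q) :
  S1_compatible (wcs_zero A) (wcs_zero B) (wcs_zero Q) (wcs_zero (azero E))
    l (wcs_of_ses (ses_of_wcs l)).
Proof.
exists (wcs_Q1 l), l, (wcs_w l),
  (cofiber_seq_of_ses (ShortExact (ses_idl (0 : azero E ~> wcs_Q1 l)))),
  (wcs_w l).
split; [exact: wcs_weq | exact: wcs_weq |].
split; [|split]; split => //=; rewrite ?comp1m ?compm1 ?compm0 //.
exact: wcs_epiE.
Qed.

Lemma pgen_absorb p : pgen (@K1wcs_relator W) (wcs_pair_of_ses (ses_pair_of_wcs p))
  = pgen (@K1wcs_relator W) p.
Proof.
case: p => A B Q l1 l2.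
have := pclass_relator (K1wcs_S1 (S1_compatible_absorb l1) (S1_compatible_absorb l2)).
rewrite !(raddfB (pclass _), raddfD (pclass _)) /=.
rewrite !(pclass_relator (K1wcs_S2 _)) !(subr0, sub0r, addr0) => /eqP.
by rewrite oppr_eq0 addrC subr_eq0 => /eqP.
Qed.

Lemma K1_to_DK : cancel K1_to_D D_to_K1.
Proof.
apply: (presented_additive_ext (f := D_to_K1 \o K1_to_D) (g := idfun)) => p /=.
by rewrite K1_to_D_gen D_to_K1_gen pgen_absorb.
Qed.

End ExactCategory.

(** * Naturality *)

Section Naturality.
Variables (E E' : exact_category) (F : exact_functor E E').

Lemma wcs_of_ses_map (A B C : E) (l : short_exact A B C) :
  wcs_of_ses (short_exact_map F l) = wcs_map (wfunctor_of F) (wcs_of_ses l).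
Proof. by apply: wcs_eq => //=; rewrite fun_id. Qed.

Lemma D_to_K1_natural (x : D_group E) :
  D_to_K1 (D_map F x) = K1wcs_map (wfunctor_of F) (D_to_K1 x).
Proof.
apply: (presented_additive_ext (f := @D_to_K1 E' \o D_map F)
  (g := K1wcs_map (wfunctor_of F) \o @D_to_K1 E)) => p /=.
rewrite D_map_gen !D_to_K1_gen K1wcs_map_gen; congr (pgen _ _).
by rewrite /wcs_pair_map /wcs_pair_of_ses /= !wcs_of_ses_map.
Qed.

End Naturality.

Theorem proposition6p3 :
  exists phi : forall E : exact_category,
      {additive D_group E -> K1wcs (waldhausen_of E)},
    (forall E : exact_category, bijective (phi E)) /\
    (forall (E E' : exact_category) (F : exact_functor E E') (x : D_group E),
        phi E' (D_map F x) = K1wcs_map (wfunctor_of F) (phi E x)).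
Proof.
exists (fun E => @D_to_K1 E : {additive _ -> _}); split=> [E|E E' F x].
  by exists (@K1_to_D E); [exact: D_to_K1K | exact: K1_to_DK].
exact: D_to_K1_natural.
Qed.
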